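(* Let $L/K$ be a finite Galois extension of fields with nonabelian Galois group $G$ and let $x\in L$. Then $x$ is a $K[G]$-generator of $L$ (i.e. $L=K[G]x$, equivalently $\{\sigma(x):\sigma\in G\}$ is a $K$-basis of $L$) if and only if $x$ is an $H_\lambda$-generator of $L$ (i.e. $L=H_\lambda\cdot x$).
   Context: Let $\lambda: G\to \mathrm{Perm}(G)$ be the left regular embedding, $\lambda(g)(h)=gh$. $G$ acts on $L[\lambda(G)]$ by $\sigma\big(\sum_{g} c_g\lambda(g)\big)=\sum_g \sigma(c_g)\lambda(\sigma g\sigma^{-1})$, and $H_\lambda=L[\lambda(G)]^G$ (the Hopf algebra of the canonical nonclassical Hopf–Galois structure on $L/K$), acting on $L$ by $\big(\sum_g c_g\lambda(g)\big)\cdot x=\sum_g c_g\, g^{-1}(x)$. *)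

(* Defs.v *)
From HB Require Import structures.
From mathcomp Require Import all_boot all_order all_algebra.
From mathcomp Require Import all_fingroup all_solvable all_field.

Set Implicit Arguments.
Unset Strict Implicit.
Unset Printing Implicit Defensive.

Import GRing.Theory GroupScope.
Local Open Scope ring_scope.

Section CanonicalNonclassical.

Variables (K : fieldType) (L : splittingFieldType K).

(* The type [gal_of {:L}] of K-automorphisms of L plays the role of G.
   Pitfall: products of automorphisms (and of permutations) are read from left
   to right here, [(g * h)%g x = h (g x)], so the composite g o h is written
   [(h * g)%g] and the conjugate s o g o s^-1 is [(g ^ s)%g]. *)
Local Notation G := (gal_of {:L}).

Lemma gal_setT : 'Gal({:L} / 1) = [set: G].
Proof.
apply/setP=> g; rewrite inE gal_kHom ?sub1v //; apply/kAHomP => x.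
by case/vlineP=> k ->; rewrite linearZ /= rmorph1.
Qed.

Lemma gal_compE (g h : G) (x : L) : (h * g)%g x = g (h x).
Proof. by rewrite galM ?memvf. Qed.

Lemma gal_conjE (s g : G) (x : L) : (g ^ s)%g x = s (g ((s^-1)%g x)).
Proof. by rewrite conjgE !galM ?memvf. Qed.

(* lambda(g)(h) = g o h *)
Definition lambda (g : G) : {perm G} := perm (@mulIg _ g).

Lemma lambdaE (g h : G) (x : L) : lambda g h x = g (h x).
Proof. by rewrite permE gal_compE. Qed.

Lemma lambdaM : {morph lambda : g h / (g * h)%g}.
Proof. by move=> g h; apply/permP=> k; rewrite permM !permE mulgA. Qed.

Lemma lambda_inj : injective lambda.
Proof. by move=> g h /permP/(_ 1%g); rewrite !permE !mul1g. Qed.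

(* The element \sum_s z_s s of L[Perm(G)] is encoded by its family of
   coefficients z; [monom c s] is the element c s. *)
Definition LPerm := {ffun {perm G} -> L}.

Definition monom (c : L) (s : {perm G}) : LPerm :=
  [ffun t => if t == s then c else 0].

Definition in_Llambda (z : LPerm) : bool :=
  [forall s, (z s != 0) ==> (s \in codom lambda)].

Definition Gact (s : G) (z : LPerm) : LPerm :=
  \sum_(g : G) monom (s (z (lambda g))) (lambda (g ^ s)%g).

Definition Hlambda (z : LPerm) : bool :=
  in_Llambda z && [forall s, Gact s z == z].

Definition Hlambda_act (z : LPerm) (x : L) : L :=
  \sum_(g : G) z (lambda g) * (g^-1)%g x.

Lemma sum_monomE (c : G -> L) (h : G) :
  (\sum_(g : G) monom (c g) (lambda g)) (lambda h) = c h.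
Proof.
rewrite sum_ffunE (bigD1 h) //= ffunE eqxx big1 ?addr0 // => g neq_gh.
by rewrite ffunE (inj_eq lambda_inj) eq_sym (negPf neq_gh).
Qed.

Lemma in_LlambdaP (z : LPerm) :
  reflect (exists c : G -> L, z = \sum_(g : G) monom (c g) (lambda g))
          (in_Llambda z).
Proof.
apply: (iffP forallP) => [zP | [c ->] s]; last first.
  apply/implyP; apply: contraR => sN; rewrite sum_ffunE big1 // => g _.
  by rewrite ffunE; case: eqP => // s_g; rewrite s_g codom_f in sN.
exists (fun g => z (lambda g)); apply/ffunP=> s.
have [/codomP[g ->] | sN] := boolP (s \in codom lambda).
  by rewrite sum_monomE.
have /implyP/contraR/(_ sN)/eqP -> := zP s.
rewrite sum_ffunE big1 // => g _; rewrite ffunE; case: eqP => // s_g.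
by rewrite s_g codom_f in sN.
Qed.

Lemma Gact_sum (s : G) (c : G -> L) :
  Gact s (\sum_(g : G) monom (c g) (lambda g)) =
  \sum_(g : G) monom (s (c g)) (lambda (g ^ s)%g).
Proof. by apply: eq_bigr => g _; rewrite sum_monomE. Qed.

Lemma Hlambda_act_sum (c : G -> L) (x : L) :
  Hlambda_act (\sum_(g : G) monom (c g) (lambda g)) x =
  \sum_(g : G) c g * (g^-1)%g x.
Proof. by apply: eq_bigr => g _; rewrite sum_monomE. Qed.

Definition KG_act (a : {ffun G -> K}) (x : L) : L := \sum_(g : G) a g *: g x.

Definition KG_generator (x : L) : Prop :=
  forall y : L, exists a : {ffun G -> K}, y = KG_act a x.

Definition Hlambda_generator (x : L) : Prop :=
  forall y : L, exists2 z : LPerm, Hlambda z & y = Hlambda_act z x.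

End CanonicalNonclassical.

(* Main.v *)
(* Applying every h in G to an equation y = \sum_g a_g g(x) with a_g in K,
   respectively to y = z . x with z in H_lambda, gives a linear system over L
   with matrix (h g(x))_(g,h), respectively (g^-1 h(x))_(g,h). By independence
   of characters these systems are solvable for all y only if the matrix is
   invertible. Conversely, if the matrix is invertible, then the unique solution
   over L is Galois equivariant, that is, it has coefficients in K, respectively
   lies in H_lambda. The two matrices are transposes of each other up to the
   permutation g |-> g^-1 of the indices. *)
From Corelib Require Import Setoid.
Require Import Defs.
From mathcomp Require Import all_boot all_order all_algebra.
From mathcomp Require Import all_fingroup all_solvable all_field.

Set Implicit Arguments.
Unset Strict Implicit.
Unset Printing Implicit Defensive.

Import GRing.Theory.
Local Open Scope ring_scope.

Section FinTypeSystems.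

Variables (R : fieldType) (T : finType).
Implicit Types (F : T -> T -> R) (c d w : T -> R).

(** Trivial left kernel of the square matrix [F]. Indexing by [T] itself lets group elements serve
    as row and column indices. *)
Definition left_regular F :=
  forall c, (forall h, \sum_g c g * F g h = 0) -> forall g, c g = 0.

Definition right_regular F :=
  forall w, (forall g, \sum_h w h * F g h = 0) -> forall h, w h = 0.

Definition fin_mx F : 'M[R]_#|T| := \matrix_(i, j) F (enum_val i) (enum_val j).

Lemma fin_mxE F c h :
  ((\row_i c (enum_val i)) *m fin_mx F) 0 (enum_rank h) = \sum_g c g * F g h.
Proof.
rewrite mxE [RHS](reindex (@enum_val T T)) /=; last exact/onW_bij/enum_val_bij.
by apply: eq_bigr => i _; rewrite !mxE enum_rankK.
Qed.

Lemma row_enum (v : 'rV[R]_#|T|) : (\row_i v 0 (enum_rank (enum_val i))) = v.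
Proof. by apply/rowP=> i; rewrite mxE enum_valK. Qed.

Lemma left_regular_unitmx F : left_regular F <-> fin_mx F \in unitmx.
Proof.
split=> [Freg | Funit c cF0 g].
  rewrite -row_free_unit -kermx_eq0; apply/rowV0P=> v /sub_kermxP vF0.
  apply/rowP=> i; rewrite mxE -[i]enum_valK.
  apply: (Freg (fun g => v 0 (enum_rank g))) => h.
  by rewrite -fin_mxE row_enum vF0 mxE.
pose v : 'rV[R]_#|T| := \row_i c (enum_val i).
have v0: v = 0.
  apply: (can_inj (mulmxK Funit)); rewrite mul0mx.
  by apply/rowP=> i; rewrite -[i]enum_valK fin_mxE cF0 mxE.
by move/rowP: v0 => /(_ (enum_rank g)); rewrite !mxE enum_rankK.
Qed.

(** Invertibility of a square matrix passes to its transpose, whose left kernel is the right kernel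
    of [F]. *)
Lemma left_right_regular F : left_regular F <-> right_regular F.
Proof.
have -> : right_regular F = left_regular (fun g h => F h g) by [].
rewrite !left_regular_unitmx -unitmx_tr.
suff -> : (fin_mx F)^T = fin_mx (fun g h => F h g) by [].
by apply/matrixP=> i j; rewrite !mxE.
Qed.

Lemma left_regular_solve F (y : T -> R) :
  left_regular F -> exists c, forall h, \sum_g c g * F g h = y h.
Proof.
move=> /left_regular_unitmx Funit.
pose v := (\row_i y (enum_val i)) *m invmx (fin_mx F).
exists (fun g => v 0 (enum_rank g)) => h.
by rewrite -fin_mxE row_enum mulmxKV // mxE enum_rankK.
Qed.

Lemma left_regular_uniq F c d :
    left_regular F ->
    (forall h, \sum_g c g * F g h = \sum_g d g * F g h) ->
  c =1 d.
Proof.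
move=> Freg cd g; apply/eqP; rewrite -subr_eq0; apply/eqP.
apply: (Freg (fun g => c g - d g)) => h.
under eq_bigr => k _ do rewrite mulrBl.
by rewrite sumrB cd subrr.
Qed.

End FinTypeSystems.

Section Generators.

Variables (K : fieldType) (L : splittingFieldType K).
Local Notation G := (gal_of {:L}).
Implicit Types (x y : L) (g h s : G).

Lemma gal_mulKV g x : g ((g^-1)%g x) = x.
Proof. by rewrite -gal_compE mulVg gal_id. Qed.

Lemma gal_mulK g x : (g^-1)%g (g x) = x.
Proof. by rewrite -gal_compE mulgV gal_id. Qed.

Lemma gal_conjM s g x : (g ^ s)%g (s x) = s (g x).
Proof. by rewrite gal_conjE gal_mulK. Qed.

Lemma GactE s (z : LPerm L) g : Gact s z (lambda (g ^ s)%g) = s (z (lambda g)).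
Proof.
rewrite /Gact (reindex_inj (conjg_inj (s^-1)%g)) /=.
under eq_bigr => h _ do rewrite conjgKV.
by rewrite sum_monomE conjgK.
Qed.

(** As [lambda] is injective, coefficients can be compared one by one, and [s] moves the one at [g]
    to [g ^ s]. *)
Lemma HlambdaP (c : G -> L) :
  Hlambda (\sum_g monom (c g) (lambda g)) <->
  (forall s g, c (g ^ s)%g = s (c g)).
Proof.
split=> [/andP[_ /forallP cH] s g | cH].
  by have /eqP/ffunP/(_ (lambda (g ^ s)%g)) := cH s; rewrite GactE !sum_monomE.
apply/andP; split; first by apply/in_LlambdaP; exists c.
apply/forallP=> s; rewrite Gact_sum; apply/eqP.
rewrite [RHS](reindex_inj (conjg_inj s)) /=.
by apply: eq_bigr => g _; rewrite cH.
Qed.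

(** A vector [w] in the right kernel of [F] satisfies \sum_h w_h h(y) = 0 for every [y]; by
    Dedekind's independence of characters, [w] vanishes. *)
Lemma char_span_regular (F : G -> G -> L) :
    (forall y, exists c : G -> L, forall h, h y = \sum_g c g * F g h) ->
  left_regular F.
Proof.
move=> Fspan; apply/left_right_regular=> w wF0 h.
apply: (@gal_independent _ _ {:L}%AS xpredT w) => // y _.
have [c cE] := Fspan y.
under eq_bigr => k _ do rewrite cE mulr_sumr.
rewrite exchange_big big1 //= => g _.
under eq_bigr => k _ do rewrite mulrCA.
by rewrite -mulr_sumr wF0 mulr0.
Qed.

Lemma galois_fixed_in1 y :
  galois 1%VS {:L} -> (forall s, s y = y) -> exists a : K, y = a%:A.
Proof.
move=> galL fix_y; apply/vlineP.
rewrite -[1%VS]/(asval 1%AS) -(galois_fixedField galL).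
by apply/fixedFieldP; rewrite ?memvf.
Qed.

Lemma KG_generator_regular x :
  galois 1%VS {:L} ->
  KG_generator x <-> left_regular (fun g h : G => h (g x)).
Proof.
move=> galL; split=> [xgen | xreg y].
  apply: char_span_regular => y; have [a ->] := xgen y.
  exists (fun g => (a g)%:A) => h; rewrite rmorph_sum.
  by apply: eq_bigr => g _; rewrite /= linearZ mulr_algl.
have [c cE] := left_regular_solve (fun h : G => h y) xreg.
(* The family s(c_g) solves the same system: apply [s] to the equation at [h * s^-1], which is s^-1
   o h. Uniqueness concludes. *)
have cK s g : s (c g) = c g.
  apply: (left_regular_uniq xreg (c := fun g => s (c g))) => {g} h.
  transitivity (s (\sum_g c g * (h * s^-1)%g (g x))).
    rewrite rmorph_sum; apply: eq_bigr => g _.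
    by rewrite rmorphM /= gal_compE gal_mulKV.
  by rewrite !cE gal_compE gal_mulKV.
have /fin_all_exists[a aE] g := galois_fixed_in1 galL (cK^~ g).
(* The equation at the identity is the expansion of [y] itself. *)
exists (finfun a); have := cE 1%g; rewrite [RHS]gal_id => <-.
by apply: eq_bigr => g _; rewrite ffunE gal_id aE mulr_algl.
Qed.

Lemma Hlambda_generator_regular x :
  Hlambda_generator x <-> left_regular (fun g h : G => (g^-1)%g (h x)).
Proof.
split=> [xgen | xreg y].
  apply: char_span_regular => y.
  have [z zH ->] := xgen y; have /in_LlambdaP[c zE] := proj1 (andP zH).
  move: zH; rewrite zE Hlambda_act_sum => /HlambdaP cH.
  (* By equivariance, [h] sends the term c_g g^-1(x) to c_k k^-1(h(x)) with k = [g ^ h], so one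
     family [c] serves every [h]. *)
  exists c => h; rewrite rmorph_sum [RHS](reindex_inj (conjg_inj h)) /=.
  by apply: eq_bigr => g _; rewrite rmorphM /= cH -conjVg gal_conjM.
have [c cE] := left_regular_solve (fun h : G => h y) xreg.
exists (\sum_g monom (c g) (lambda g)); last first.
  rewrite Hlambda_act_sum; have := cE 1%g; rewrite [RHS]gal_id => <-.
  by apply: eq_bigr => g _; rewrite gal_id.
apply/HlambdaP=> s g.
(* With [g] written as the conjugate of [g ^ s] by [s^-1], the goal compares two solutions of one
   system at the index [g ^ s]. *)
rewrite -{2}[g](conjgK s).
apply: (left_regular_uniq xreg (d := fun k => s (c (k ^ s^-1)%g))) => {g} h.
transitivity (s (\sum_g c g * (g^-1)%g ((h * s^-1)%g x))).
  by rewrite !cE gal_compE gal_mulKV.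
rewrite rmorph_sum [RHS](reindex_inj (conjg_inj s)) /=; apply: eq_bigr => g _.
by rewrite rmorphM /= conjgK -conjVg gal_compE -gal_conjM gal_mulKV.
Qed.

(** If F(g,h) = h(g(x)), the second matrix has entries F(h, g^-1), so inverting the index matches
    its left kernel with the right kernel of F. *)
Lemma regular_transpose x :
  left_regular (fun g h : G => h (g x)) <->
  left_regular (fun g h : G => (g^-1)%g (h x)).
Proof.
rewrite left_right_regular; split=> xreg c c0 g.
  rewrite -[g]invgK; apply: (xreg (fun g => c (g^-1)%g)) => h.
  rewrite -[RHS](c0 h) [RHS](reindex_inj invg_inj) /=.
  by apply: eq_bigr => k _; rewrite invgK.
rewrite -[g]invgK; apply: (xreg (fun g => c (g^-1)%g)) => h.
rewrite -[RHS](c0 h) [RHS](reindex_inj invg_inj) /=.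
by apply: eq_bigr => k _.
Qed.

End Generators.

Theorem mainTheorem5 (K : fieldType) (L : splittingFieldType K)
    (galL : galois 1%VS {:L}%VS)
    (nabG : ~~ abelian 'Gal({:L}%VS / 1%VS)%g)
    (x : L) :
  KG_generator x <-> Hlambda_generator x.
Proof.
by rewrite KG_generator_regular // Hlambda_generator_regular regular_transpose.
Qed.
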